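(* Let $G$ be a finite simple connected graph. Then the cut polytope $\mathrm{Cut}^\Box(G)$ of $G$ satisfies condition (E).
   Context: Cut polytope: let $G$ have vertex set $V=\{1,\dots,n\}$ and edge set $E$. For $S\subset V$ let $\delta_G(S)=(d_{ij})_{\{i,j\}\in E}\in\{0,1\}^E$ with $d_{ij}=1$ if $|S\cap\{i,j\}|=1$ and $d_{ij}=0$ otherwise. Then $\mathrm{Cut}^\Box(G)=\mathrm{conv}\{\delta_G(S):S\subset V\}\subset\mathbb{R}^E$. A polytope $P$ with all vertices $(0,1)$-vectors satisfies condition (E) if: two distinct vertices $\mathbf{a}$ and $\mathbf{b}$ of $P$ form an edge of $P$ (i.e. $\mathrm{conv}(\{\mathbf{a},\mathbf{b}\})$ is an edge) if and only if there exists a unique way (up to order) to write $\mathbf{a}+\mathbf{b}$ as the sum of two (not necessarily distinct) vertices of $P$. *)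

(* Defs.v *)
From mathcomp Require Import all_boot all_order all_algebra.
From mathcomp Require Import boolp classical_sets reals convex.
Set Implicit Arguments.
Unset Strict Implicit.
Unset Printing Implicit Defensive.
Import Order.TTheory GRing.Theory Num.Theory.

Local Open Scope ring_scope.
Local Open Scope classical_set_scope.

Definition conv_hull (R : realType) (V : lmodType R) (A : set V) : set V :=
  smallest (@convex_set R V) A.

Definition is_polytope (R : realType) (V : lmodType R) (P : set V) : Prop :=
  exists s : seq V, P = conv_hull [set` s].

(* The subset of P on which some inequality valid on P is tight; f = 0 is
   allowed, so P itself (b = 0) and the empty set (b = 1) are faces of P. *)
Definition is_face (R : realType) (V : lmodType R) (P F : set V) : Prop :=
  exists (f : {scalar V}) (b : R),
    (forall x, P x -> f x <= b) /\ F = [set x | P x /\ f x = b].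

(* F is nonempty and its affine hull has dimension d: U is the smallest linear
   subspace with F contained in p + U. *)
Definition has_dim (R : realType) (V : vectType R) (F : set V) (d : nat) : Prop :=
  exists (p : V) (U : {vspace V}),
    [/\ F p, \dim U = d, forall x, F x -> x - p \in U
      & forall W : {vspace V}, (forall x, F x -> x - p \in W) -> (U <= W)%VS].

Definition is_vertex (R : realType) (V : vectType R) (P : set V) (v : V) : Prop :=
  is_face P [set v].

Definition is_edge (R : realType) (V : vectType R) (P F : set V) : Prop :=
  is_face P F /\ has_dim F 1.

Definition zero_one_polytope (R : realType) (I : finType)
    (P : set {ffun I -> R^o}) : Prop :=
  is_polytope P /\
  forall v : {ffun I -> R^o}, is_vertex P v -> forall i, v i = 0 \/ v i = 1.

Definition uniquely_decomposable (R : realType) (V : vectType R)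
    (P : set V) (w : V) : Prop :=
  exists c d : V,
    [/\ is_vertex P c, is_vertex P d, w = c + d
      & forall c' d' : V, is_vertex P c' -> is_vertex P d' -> w = c' + d' ->
          (c' = c /\ d' = d) \/ (c' = d /\ d' = c)].

Definition condition_E (R : realType) (I : finType)
    (P : set {ffun I -> R^o}) : Prop :=
  zero_one_polytope P /\
  forall a b : {ffun I -> R^o}, is_vertex P a -> is_vertex P b -> a <> b ->
    (is_edge P (conv_hull [set a; b]) <-> uniquely_decomposable P (a + b)).

Record sgraph (n : nat) := SGraph {
  edges : {set {set 'I_n}};
  edges_card2 : forall e, e \in edges -> #|e| = 2
}.

Definition edge (n : nat) (G : sgraph n) : finType :=
  {e : {set 'I_n} | e \in edges G}.

Definition adjacent (n : nat) (G : sgraph n) : rel 'I_n :=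
  fun i j => [set i; j]%SET \in edges G.

Definition connected_graph (n : nat) (G : sgraph n) : Prop :=
  (0 < n)%N /\ forall i j : 'I_n, connect (adjacent G) i j.

Definition cut_vector (R : realType) (n : nat) (G : sgraph n) (S : {set 'I_n}) :
    {ffun edge G -> R^o} :=
  [ffun e : edge G => if #|S :&: val e| == 1%N then 1 else 0].

Definition cut_polytope (R : realType) (n : nat) (G : sgraph n) :
    set {ffun edge G -> R^o} :=
  conv_hull (range (@cut_vector R n G)).

Arguments cut_vector R {n} G S.
Arguments cut_polytope R {n} G _.

(* Main.v *)
Require Import Defs.
From mathcomp Require Import all_boot all_order all_algebra.
From mathcomp Require Import boolp classical_sets reals convex.
From HB Require Import structures.
From mathcomp Require Import interval_inference lra.

(** Cut vectors form a binary linear code: modulo 2, the vector of S plus the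
    vector of T is the vector of their symmetric difference.  The theorem holds
    for the convex hull of any family A of (0,1)-vectors that is closed under
    sums modulo 2 of three members ([condition_E_conv_hull]).

    Faces of conv A are convex hulls of the members of A lying on them
    ([face_conv_hull]), so every vertex of conv A is in A.  Conversely, given a
    (0,1)-vector a and a set D of coordinates, the functional whose coefficient
    is 1 where a is 1 and -1 where a is 0, outside D, and 0 on D, is maximal on
    A exactly at the members which agree with a outside D
    ([agreement_face]).  With D empty this shows that every member of A is a
    vertex.

    Let now a and b be distinct members of A.

    If conv {a, b} is a face and a + b = c + d, then the functional defining the
    face is maximal at c and d as well, so that c and d lie on the segment;
    being vertices, they are among a and b.  This direction holds in every
    convex set ([edge_uniquely_decomposable]).

    Conversely, let D be the set of coordinates at which a and b differ.  If c
    in A agrees with a outside D, then a + b - c is the sum modulo 2 of a, b and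
    c, so it is in A, and a + b = c + (a + b - c) is a decomposition.  If a + b
    decomposes uniquely, c is a or b.  The face cut out by the functional of a
    and D is then conv {a, b}. *)

Set Implicit Arguments.
Unset Strict Implicit.
Unset Printing Implicit Defensive.
Import Order.TTheory GRing.Theory Num.Theory.

Local Open Scope ring_scope.
Local Open Scope classical_set_scope.

(** * Convex hulls and their faces *)

Section ConvexHull.
Variables (R : realType) (V : lmodType R).
Implicit Types (A B P : set V) (f : {scalar V}) (b : R).

Lemma convex_setE A :
  convex_set A <->
  forall x y (t : R), A x -> A y -> 0 < t -> t < 1 ->
    A (t *: x + (1 - t) *: y).
Proof.
split=> [cA x y t Ax Ay t0 t1|cA].
  have := cA x y (Itv01 (ltW t0) (ltW t1)); rewrite !inE.
  exact.
apply/convex_setW => x y; rewrite !inE => Ax Ay k k0 k1.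
by rewrite inE; exact: cA.
Qed.

Lemma sub_conv_hull A : A `<=` conv_hull A.
Proof. exact: sub_gen_smallest. Qed.

Lemma conv_hull_min A B : convex_set B -> A `<=` B -> conv_hull A `<=` B.
Proof. exact: smallest_sub. Qed.

Lemma convex_conv_hull A : convex_set (conv_hull A).
Proof.
apply/convex_setE => x y t Ax Ay t0 t1 B [cB AB].
move/convex_setE: (cB); apply => //; [exact: Ax|exact: Ay].
Qed.

Lemma linear_segment f (t : R) (x y : V) :
  f (t *: x + (1 - t) *: y) = t * f x + (1 - t) * f y.
Proof. by rewrite linearD !linearZ. Qed.

Lemma conv_hull_le f b A :
  (forall x, A x -> f x <= b) -> forall x, conv_hull A x -> f x <= b.
Proof.
move=> Ab; apply: conv_hull_min Ab.
apply/convex_setE => x y t /= fx fy t0 t1.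
rewrite linear_segment; nra.
Qed.

(** The set B below is convex because a point strictly inside a segment can only
    maximize f if both end points do. *)
Lemma face_conv_hull f b A : (forall x, A x -> f x <= b) ->
  [set x | conv_hull A x /\ f x = b] = conv_hull [set x | A x /\ f x = b].
Proof.
move=> Ab; apply/seteqP; split=> [x [Ax]|].
  pose C := conv_hull [set x | A x /\ f x = b].
  pose B := [set x | f x <= b /\ (f x = b -> C x)].
  suff /(_ x Ax) [_] : conv_hull A `<=` B by [].
  apply: conv_hull_min; last first.
    by move=> y Ay; split=> [|fy]; [exact: Ab|exact: sub_conv_hull].
  apply/convex_setE => y z t [fy Cy] [fz Cz] t0 t1.
  rewrite /B /= linear_segment; split=> [|e]; first by nra.
  have cC := (convex_setE C).1 (@convex_conv_hull _).
  apply: cC => //; [apply: Cy|apply: Cz]; nra.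
apply: conv_hull_min => [|x [Ax fx]]; last by split=> //; exact: sub_conv_hull.
apply/convex_setE => x y t [Ax fx] [Ay fy] t0 t1; split.
  by apply: (convex_setE _).1 => //; exact: convex_conv_hull.
by rewrite linear_segment fx fy; lra.
Qed.

Lemma conv_hull_set0 : conv_hull (@set0 V) = set0.
Proof.
by apply/seteqP; split=> //; apply: conv_hull_min => // x y t; rewrite inE.
Qed.

Lemma conv_hull_set1 (a : V) : conv_hull [set a] = [set a].
Proof.
apply/seteqP; split; last exact: sub_conv_hull.
apply: conv_hull_min => //; apply/convex_setE => x y t -> -> _ _ /=.
by rewrite -scalerDl addrC subrK scale1r.
Qed.

End ConvexHull.

(** * Vertices and edges *)

Section VerticesEdges.
Variables (R : realType) (V : vectType R).
Implicit Types (A P Q : set V) (a b v : V).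

Lemma is_vertex_mem P v : is_vertex P v -> P v.
Proof.
move=> [f [b [_ e]]].
by have [] : [set x | P x /\ f x = b] v by rewrite -e.
Qed.

Lemma is_vertex_sub P Q v : Q `<=` P -> Q v -> is_vertex P v -> is_vertex Q v.
Proof.
move=> QP Qv [f [b [Pb e]]]; exists f, b; split=> [x /QP /Pb //|].
have [_ fv] : [set x | P x /\ f x = b] v by rewrite -e.
apply/seteqP; split=> [x ->//|x [Qx fx]].
by rewrite e; split=> //; exact: QP.
Qed.

(** The hull of the members of A lying on the face {v} is nonempty, so there is
    such a member; it can only be v. *)
Lemma is_vertex_conv_hull A v : is_vertex (conv_hull A) v -> A v.
Proof.
move=> [f [b [Ab e]]].
have eA := face_conv_hull (fun x Ax => Ab x (sub_conv_hull Ax)).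
have [E|/set0P[x [Ax fx]]] := eqVneq [set x | A x /\ f x = b] set0.
  have : [set v] v by [].
  by rewrite e eA E conv_hull_set0.
suff -> : v = x by [].
by apply/esym; rewrite -[_ = _]/([set v] x) e; split=> //; exact: sub_conv_hull.
Qed.

Lemma has_dim_segment a b : a <> b -> has_dim (conv_hull [set a; b]) 1.
Proof.
move=> /eqP ab; exists a, <[b - a]>%VS; split.
- by apply: sub_conv_hull; left.
- by rewrite dim_vline subr_eq0 eq_sym ab.
- apply: (@conv_hull_min _ _ _ [set x | x - a \in <[b - a]>%VS]).
    apply/convex_setE => x y t /= xU yU _ _.
    have -> : t *: x + (1 - t) *: y - a = t *: (x - a) + (1 - t) *: (y - a).
      rewrite !scalerBr addrACA -opprD -scalerDl.
      by rewrite [t + _]addrC subrK scale1r.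
    by rewrite memvD ?memvZ.
  by move=> x [->|->] /=; rewrite ?subrr ?mem0v ?memv_line.
- move=> W aW; rewrite -memvE; apply: aW.
  by apply: sub_conv_hull; right.
Qed.

(** In a sum c + d = a + b both c and d must maximize the functional defining
    the edge, so they are vertices lying on the segment from a to b, whose only
    vertices are its ends. *)
Lemma edge_uniquely_decomposable P a b :
  is_vertex P a -> is_vertex P b -> is_edge P (conv_hull [set a; b]) ->
  uniquely_decomposable P (a + b).
Proof.
move=> Pa Pb [[f [m [Pm e]]] _]; exists a, b; split=> // c d Pc Pd E.
have on x : conv_hull [set a; b] x -> P x /\ f x = m by rewrite e.
have [_ fa] : P a /\ f a = m by apply: on; apply: sub_conv_hull; left.
have [_ fb] : P b /\ f b = m by apply: on; apply: sub_conv_hull; right.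
have fE : f a + f b = f c + f d by rewrite -!linearD E.
have fc := Pm c (is_vertex_mem Pc); have fd := Pm d (is_vertex_mem Pd).
have ends x : is_vertex P x -> f x = m -> [set a; b] x.
  move=> Px fx; apply: is_vertex_conv_hull; apply: (is_vertex_sub _ _ Px).
    by move=> y /on [].
  by rewrite e; split=> //; exact: is_vertex_mem Px.
have [|ca|cb] := ends c Pc; first by lra.
  by left; split=> //; move: E; rewrite ca => /addrI.
by right; split=> //; move: E; rewrite cb addrC => /addrI.
Qed.

End VerticesEdges.

(** * Families of (0,1)-vectors closed under sums modulo 2 *)

Section ZeroOne.
Variables (R : realType) (I : finType).
Local Notation vec := {ffun I -> R^o}.
Implicit Types (a b c : vec) (D : pred I).

Definition zero_one (a : vec) := forall i, a i = 0 \/ a i = 1.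

Definition agree_off D (a c : vec) := forall i, ~~ D i -> c i = a i.

(** For (0,1)-vectors a and x, this is a constant depending on a and D, minus the
    Hamming distance between a and x outside D. *)
Definition agreement a D (x : vec) : R^o :=
  \sum_(i | ~~ D i) (2 * a i - 1) * x i.

Fact agreement_is_linear a D : linear (agreement a D).
Proof.
move=> k x y; rewrite /agreement scaler_sumr -big_split /=.
by apply: eq_bigr => i _; rewrite !ffunE mulrDr; congr (_ + _); rewrite mulrCA.
Qed.

HB.instance Definition _ a D :=
  GRing.isLinear.Build R vec R^o *:%R (agreement a D) (agreement_is_linear a D).

(** The bound and its equality case hold term by term: where the coefficient
    2 * a i - 1 is 1, a i is the larger of the two values possible for c i, and
    where it is -1, the smaller. *)
Lemma agreement_max a D c : zero_one a -> zero_one c ->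
  agreement a D c <= agreement a D a /\
  (agreement a D c = agreement a D a <-> agree_off D a c).
Proof.
move=> a01 c01.
have tle i : (2 * a i - 1) * c i <= (2 * a i - 1) * a i.
  by case: (a01 i) => ->; case: (c01 i) => ->; lra.
split; first by apply: ler_sum => i _; exact: tle.
split=> [/esym/eqP|ac]; last by apply: eq_bigr => i /ac ->.
rewrite -subr_eq0 -sumrB => /eqP e i iD.
have /(_ i iD)/eqP := psumr_eq0P (fun j _ => etrans (subr_ge0 _ _) (tle j)) e.
by case: (a01 i) => ->; case: (c01 i) => ->; lra.
Qed.

Lemma agreement_face (A : set vec) a D : (forall c, A c -> zero_one c) ->
  zero_one a -> is_face (conv_hull A) (conv_hull [set c | A c /\ agree_off D a c]).
Proof.
move=> A01 a01; exists (agreement a D), (agreement a D a).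
have Ale c : A c -> agreement a D c <= agreement a D a.
  by move=> /A01 c01; have [] := agreement_max D a01 c01.
split; first exact: (conv_hull_le (f := agreement a D)).
rewrite (face_conv_hull (f := agreement a D)) //; congr conv_hull.
apply/seteqP; split=> c [Ac] h; split=> //;
  by have [_ [h1 h2]] := agreement_max D a01 (A01 c Ac); auto.
Qed.

Lemma is_vertex_zero_one (A : set vec) a : (forall c, A c -> zero_one c) ->
  A a -> is_vertex (conv_hull A) a.
Proof.
move=> A01 Aa; have := agreement_face pred0 A01 (A01 a Aa).
rewrite /is_vertex -[in X in _ -> X]conv_hull_set1; congr (is_face _ (conv_hull _)).
apply/seteqP; split=> c /= [Ac]; last by rewrite Ac.
by move=> ac; apply/ffunP => i; exact: ac.
Qed.

(** Where a and b agree, so does c, hence a + b - c has entries 0 and 1 and is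
    the sum of a, b and c modulo 2. *)
Definition closed_sum3 (A : set vec) := forall a b c, A a -> A b -> A c ->
  agree_off [pred i | a i != b i] a c -> A (a + b - c).

(** A unique decomposition of a + b leaves only a and b among the members that
    agree with a wherever b does: any such x comes with the decomposition
    x + (a + b - x).  Hence the agreement face is the segment. *)
Lemma condition_E_conv_hull (s : seq vec) :
  (forall c, c \in s -> zero_one c) -> closed_sum3 [set` s] ->
  condition_E (conv_hull [set` s]).
Proof.
move=> s01 s3; set A := [set` s].
have vA c : is_vertex (conv_hull A) c <-> A c.
  by split; [exact: is_vertex_conv_hull|exact: is_vertex_zero_one].
split; first by split=> [|v /vA]; [exists s|exact: s01].
move=> a b va vb ab; split; first exact: edge_uniquely_decomposable.
have [Aa Ab] := ((vA a).1 va, (vA b).1 vb).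
move=> [c [d [_ _ _ uniq]]]; split; last exact: has_dim_segment.
suff -> : [set a; b] = [set x | A x /\ agree_off [pred i | a i != b i] a x].
  by apply: agreement_face => //; exact: s01.
apply/seteqP; split=> [x [->|->]|x [Ax ax]].
- by split.
- by split=> // i /= /negPn /eqP.
- have Ay := s3 _ _ _ Aa Ab Ax ax.
  have x_or y : A y -> A (a + b - y) -> y = c \/ y = d.
    move=> /vA vy /vA vy'.
    by have [[]|[]] := uniq y _ vy vy' (esym (subrKC _ _)); [left|right].
  have aE : a = c \/ a = d by apply: x_or => //; rewrite addrAC subrr add0r.
  have bE : b = c \/ b = d by apply: x_or => //; rewrite addrK.
  have := x_or x Ax Ay.
  case: aE bE ab => -> [] -> ab [] ->; by [left|right|case: ab].
Qed.

End ZeroOne.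

(** * Cuts *)

Section Cuts.
Variables (R : realType) (n : nat) (G : sgraph n).
Implicit Types (S T : {set 'I_n}) (e : edge G).

Lemma cut_vector_addb e : exists i j, forall S,
  cut_vector R G S e = ((i \in S) (+) (j \in S))%:R.
Proof.
have /eqP/cards2P[i [j [ij eE]]] := edges_card2 (valP e).
exists i, j => S; rewrite ffunE eE (cardsD1 i) (cardsD1 j).
rewrite (_ : _ :\ i :\ j = finset.set0)%SET; last first.
  apply/setP => k; rewrite !inE.
  by case: (k =P i); case: (k =P j) => // *; rewrite ?andbF.
rewrite cards0 !inE !eqxx [j == i]eq_sym ij /= orbT !andbT.
by case: (i \in S); case: (j \in S).
Qed.

Lemma cut_vector_zero_one S : zero_one (cut_vector R G S).
Proof. by move=> e; rewrite ffunE; case: ifP; [right|left]. Qed.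

(** The sum modulo 2 of three cut vectors is the cut vector of the symmetric
    difference of the three vertex sets. *)
Lemma cut_vector_closed_sum3 : closed_sum3 (range (cut_vector R G)).
Proof.
move=> _ _ _ [S _ <-] [T _ <-] [U _ <-] U_agree.
exists [set x | (x \in S) (+) (x \in T) (+) (x \in U)]%SET => //.
apply/ffunP => e; have [i [j E]] := cut_vector_addb e.
have addBE (a b c : {ffun edge G -> R^o}) : (a + b - c) e = a e + b e - c e.
  by rewrite !ffunE.
have := U_agree e; rewrite addBE /= negbK !E !finset.inE.
set x := (i \in S) (+) _; set y := (i \in T) (+) _; set z := (i \in U) (+) _.
have -> : (i \in S) (+) (i \in T) (+) (i \in U) (+)
    ((j \in S) (+) (j \in T) (+) (j \in U)) = x (+) y (+) z.
  rewrite {}/x {}/y {}/z.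
  by do 3![case: (i \in _)]; do 3![case: (j \in _)].
(* If x = y then z = x by agreement; otherwise both sides are 1 - z. *)
case: x; case: y; case: z => /= h; rewrite ?addr0 ?add0r ?subr0 ?addrK ?subrr
  ?oppr0 //.
  by have /esym/eqP := h (eqxx _); rewrite oner_eq0.
by have /eqP := h (eqxx _); rewrite oner_eq0.
Qed.

End Cuts.

Theorem lemma3p13 (R : realType) (n : nat) (G : sgraph n)
  (hG : connected_graph G) : condition_E (cut_polytope R G).
Proof.
have rangeE : range (cut_vector R G) =
    [set` [seq cut_vector R G X | X : {set 'I_n}]].
  apply/seteqP; split=> [_ [S _ <-]|c /= /mapP[S _ ->]].
    exact: (fintype.image_f (cut_vector R G)).
  by exists S.
rewrite /cut_polytope rangeE; apply: condition_E_conv_hull.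
  by move=> c /mapP[S _ ->]; exact: cut_vector_zero_one.
by rewrite -rangeE; exact: cut_vector_closed_sum3.
Qed.
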